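(* Let $k \geq 5$. Any (perhaps randomized) distributed $\alpha$-approximation algorithm in the CONGEST model for the minimum directed $k$-spanner problem takes $\Omega\!\left(\frac{\sqrt{n}}{\sqrt{\alpha}\cdot \log n}\right)$ rounds on some $n$-vertex input graphs, for $1 \leq \alpha \leq \frac{n}{100}$.
   Context: Directed $k$-spanner: for a directed graph $G=(V,E)$, a subgraph $H\subseteq E$ is a $k$-spanner if for every edge $(u,v)\in E$, $H$ contains a directed path of length at most $k$ from $u$ to $v$. The minimum directed $k$-spanner problem asks for a $k$-spanner with the minimum number of edges. An $\alpha$-approximation algorithm outputs a $k$-spanner whose size is at most $\alpha$ times the minimum size. The approximation ratio $\alpha=\alpha(n)$ may depend on the number of vertices $n$; it is assumed to be a monotonically non-decreasing function of $n$ such that $n=\Theta(n')$ implies $\alpha(n)=\Theta(\alpha(n'))$. Distributed setting: the input graph is the communication network; vertices have unique IDs, each vertex initially knows only its incident edges (and their directions), computation proceeds in synchronous rounds, and communication over each edge is bidirectional even though the graph is directed. Each vertex outputs a subset of its incident edges, and the union of outputs is the spanner. In the CONGEST model, in each round each vertex may send a message of $O(\log n)$ bits over each incident edge. *)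

(* Defs.v *)
From HB Require Import structures.
From mathcomp Require Import all_boot all_order all_algebra finmap.
From mathcomp Require Import all_classical all_reals all_analysis.

Set Implicit Arguments.
Unset Strict Implicit.
Unset Printing Implicit Defensive.

Import Order.TTheory GRing.Theory Num.Theory.

Local Open Scope ring_scope.
Local Open Scope classical_set_scope.

(* A directed graph on 'I_n is its set of edges, (u, v) being the edge from
   u to v; antiparallel pairs of edges are allowed. *)
Definition digraph (n : nat) := {set 'I_n * 'I_n}.

Definition is_spanner (k n : nat) (E H : digraph n) : Prop :=
  H \subset E /\
  forall u v : 'I_n, (u, v) \in E ->
    exists p : seq 'I_n,
      [/\ path [rel x y | (x, y) \in H] u p, last u p = v & (size p <= k)%N].

Definition is_min_spanner (k n : nat) (E H : digraph n) : Prop :=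
  is_spanner k E H /\
  forall H' : digraph n, is_spanner k E H' -> (#|H| <= #|H'|)%N.

Definition is_approx_spanner (R : realType) (k : nat) (a : R) (n : nat)
    (E H : digraph n) : Prop :=
  is_spanner k E H /\
  forall H' : digraph n, is_min_spanner k E H' -> #|H|%:R <= a * #|H'|%:R.

(* An input of size n: a loopless directed graph whose vertices carry
   distinct identifiers smaller than n ^ d, i.e. of O(log n) bits. *)
Record network (d n : nat) := Network {
  edges : digraph n;
  edges_loopless : forall v : 'I_n, (v, v) \notin edges;
  id_of : 'I_n -> nat;
  id_inj : injective id_of;
  id_bound : forall v : 'I_n, (id_of v < n ^ d)%N }.

(* What a vertex knows at the start; an incident edge is known through the
   identifier of its other endpoint. *)
Record local_input := LocalInput {
  own_id : nat;
  out_ids : {fset nat};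
  in_ids : {fset nat} }.

Definition tape := nat -> bool.

(* [send s i] is the message for the neighbour with identifier [i].  In
   [step s inbox], [inbox i] is the message just received from the neighbour
   with identifier [i] ([::] if there is none).  [output s] is a set of
   directed edges, given by the identifiers of their endpoints.  Local
   computation is unrestricted. *)
Record algorithm := Algorithm {
  state : Type;
  init : local_input -> tape -> state;
  send : state -> nat -> seq bool;
  step : state -> (nat -> seq bool) -> state;
  halted : state -> bool;
  output : state -> {fset (nat * nat)} }.

Section Execution.
Variables (A : algorithm) (d n : nat) (G : network d n).

(* Communication is bidirectional. *)
Definition linked (u v : 'I_n) : bool :=
  ((u, v) \in edges G) || ((v, u) \in edges G).

Definition input_of (v : 'I_n) : local_input :=
  LocalInput (id_of G v)
    [fset id_of G u | u in 'I_n & (v, u) \in edges G]%fset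
    [fset id_of G u | u in 'I_n & (u, v) \in edges G]%fset.

(* A halted vertex sends nothing and never changes state again. *)
Definition message (st : 'I_n -> state A) (u v : 'I_n) : seq bool :=
  if halted (st u) then [::] else send (st u) (id_of G v).

Definition inbox (st : 'I_n -> state A) (v : 'I_n) (i : nat) : seq bool :=
  if [pick u | linked u v && (id_of G u == i)] is Some u
  then message st u v else [::].

Definition round (st : 'I_n -> state A) (v : 'I_n) : state A :=
  if halted (st v) then st v else step (st v) (inbox st v).

Definition run (r : 'I_n -> tape) (t : nat) : 'I_n -> state A :=
  iter t round (fun v => init A (input_of v) (r v)).

Definition all_halted (r : 'I_n -> tape) (t : nat) : Prop :=
  forall v : 'I_n, halted (run r t v).

(* Intersecting with the edge set and asking only the two endpoints makes each
   vertex contribute a subset of its incident edges. *)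
Definition output_graph (r : 'I_n -> tape) (t : nat) : digraph n :=
  [set e in edges G |
     let ids := (id_of G e.1, id_of G e.2) in
     (ids \in output (run r t e.1)) || (ids \in output (run r t e.2))]%SET.

End Execution.

(* Every message on an edge has at most B log n bits. *)
Definition is_congest (R : realType) (B : R) (d : nat) (A : algorithm) : Prop :=
  forall (n : nat) (G : network d n) (r : 'I_n -> tape) (t : nat) (u v : 'I_n),
    linked G u v ->
    (size (message G (run A G r t) u v))%:R <= B * ln (n%:R : R).

Section Randomness.
Variables (R : realType) (dO : measure_display) (Omega : measurableType dO).
Variables (P : probability Omega R) (flip : nat -> nat -> Omega -> bool).

(* The bits [flip v i] are unbiased and mutually independent. *)
Definition fair_coins : Prop :=
  (forall v i : nat, measurable [set w | flip v i w]) /\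
  forall (s : seq (nat * nat)) (b : nat * nat -> bool), uniq s ->
    P [set w | all (fun vi => flip vi.1 vi.2 w == b vi) s]
      = ((2%:R^-1) ^+ size s)%:E.

(* The private tape of each vertex. *)
Definition tapes (n : nat) (w : Omega) (v : 'I_n) : tape :=
  fun i => flip v i w.

Definition succeeds (k : nat) (a : R) (A : algorithm) (d n : nat)
    (G : network d n) (w : Omega) : Prop :=
  exists t : nat, all_halted A G (tapes w) t /\
    is_approx_spanner k a (edges G) (output_graph A G (tapes w) t).

(* Success with probability at least 2/3 on every input. *)
Definition is_approx_algorithm (k : nat) (alpha : nat -> R) (d : nat)
    (A : algorithm) : Prop :=
  forall (n : nat) (G : network d n),
    exists S : set Omega,
      [/\ measurable S, S `<=` [set w | succeeds k (alpha n) A G w]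
        & ((2%:R / 3%:R)%:E <= P S)%E].

(* With positive probability the execution is not over in fewer than x
   rounds. *)
Definition takes_rounds (A : algorithm) (d n : nat) (G : network d n)
    (x : R) : Prop :=
  ~ (\forall w \ae P,
       exists t : nat, all_halted A G (tapes w) t /\ t%:R < x).

End Randomness.

Definition theta_stable (R : realType) (alpha : nat -> R) : Prop :=
  forall C : R, 0 < C -> exists D : R, 0 < D /\
    forall m n : nat, m%:R <= C * n%:R -> n%:R <= C * m%:R ->
      alpha m <= D * alpha n.

(* Main.v *)
(* Hard instances.  A pair of l * l bits (a, b) is encoded in a DAG with l groups
   of beta sources and l groups of beta targets, every source being joined to
   every target.  Apart from these dense edges, a target of group j can be
   reached from a source of group i only through hubs x_i, y_j, directly if
   a_ij = 0, or through a second pair of hubs x'_i, y'_j if b_ij = 0.  If a and b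
   are disjoint, the O(n) remaining edges form a 5-spanner; otherwise every
   spanner, for any k, contains beta ^ 2 dense edges, which is more than alpha
   times as much.  The hubs x', y' are attached to the rest by 2 l edges, so an
   algorithm running in t rounds yields a protocol for disjointness of l ^ 2 bits
   that communicates O(l t log n) bits.

   Disjointness.  Let mu_0 be the law of a random disjoint pair of N-bit strings
   and mu_e its perturbation with the same marginals in which each coordinate is
   (1, 1) with probability e.  Every rectangle Q satisfies
   mu_e(Q) >= mu_0(Q) ^ (1 + s) with s = 256 e: given which of the two strings is
   forced to be 0 in each coordinate, mu_0 is a product measure, so that the
   functional form of this inequality tensorizes, and for one coordinate it is a
   two-point inequality.  With e of order 1 / N, summing over the rectangles of a
   protocol that errs with probability at most 1/3 shows that there are
   exp(Omega(N)) of them. *)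

Require Import Defs.
From mathcomp Require Import all_boot all_order all_algebra finmap.
From mathcomp Require Import all_classical all_reals all_analysis.
From mathcomp Require Import measurable_realfun ring lra.
Import Order.TTheory GRing.Theory Num.Theory.
Local Open Scope ring_scope.

Set Implicit Arguments.
Unset Strict Implicit.

(** * The two-point inequality *)

(** From [exp z >= 1 + z] at [z = s ln u], and [ln u = 2 ln r >= 2 (1 - 1 / r)] for [r = sqrt u]. *)
Lemma powR1D_ge (R : realType) (s u : R) : 0 <= s -> 0 <= u ->
  u + 2 * s * (u - Num.sqrt u) <= u `^ (1 + s).
Proof.
move=> s0 u0; have [->|un0] := eqVneq u 0.
  by rewrite sqrtr0 subr0 mulr0 addr0 powR_ge0.
have up : 0 < u by rewrite lt_neqAle eq_sym un0.
set r := Num.sqrt u.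
have rp : 0 < r by rewrite sqrtr_gt0.
have ur : u = r * r by rewrite -expr2 sqr_sqrtr.
have lnr : 1 - r^-1 <= ln r.
  have : ln (1 + (r^-1 - 1)) <= r^-1 - 1.
    by apply: le_ln1Dx; rewrite ltrBrDl subrr invr_gt0.
  by rewrite addrC subrK lnV ?posrE// => H; lra.
have lnu : ln u = 2 * ln r by rewrite ur lnM ?posrE//; lra.
have -> : u `^ (1 + s) = u * u `^ s.
  rewrite powRD ?powRr1//; first by rewrite un0 implybT.
have : 1 + s * ln u <= u `^ s by rewrite /powR (negbTE un0) expR_ge1Dx.
move=> H; apply: (@le_trans _ _ (u * (1 + s * ln u))); last by rewrite ler_wpM2l.
have rr : r * r^-1 = 1 by rewrite divff// gt_eqF.
have : u * s * (2 * (1 - r^-1)) <= u * s * ln u.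
  by apply: ler_wpM2l; [rewrite mulr_ge0//; lra | lra].
have -> : u * s * (2 * (1 - r^-1)) = 2 * s * (u - r).
  by rewrite mulrBr mulrBr !mulr1 {2}ur; ring: rr.
by move=> ?; lra.
Qed.

Lemma sqrt_pair_le (R : realType) (h : R) : 0 <= h <= 1 ->
  Num.sqrt (1 + h) + Num.sqrt (1 - h) <= 2 - h ^+ 2 / 4.
Proof.
move=> /andP[h0 h1]; have h2 : h ^+ 2 <= 1 by rewrite expr_le1.
have a0 := sqrtr_ge0 (1 + h); have b0 := sqrtr_ge0 (1 - h).
have a2 : Num.sqrt (1 + h) ^+ 2 = 1 + h by rewrite sqr_sqrtr//; lra.
have b2 : Num.sqrt (1 - h) ^+ 2 = 1 - h by rewrite sqr_sqrtr//; lra.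
move: (Num.sqrt _) (Num.sqrt _) a0 b0 a2 b2 => a b a0 b0 a2 b2.
have ab : a * b <= 1 - h ^+ 2 / 2.
  rewrite -ler_sqr ?nnegrE ?mulr_ge0//; last by nra.
  rewrite exprMn a2 b2; nra.
rewrite -ler_sqr ?nnegrE; [|lra|lra].
have := sqr_ge0 (h ^+ 2); nra.
Qed.

(** With [u = 1 + h] and [v = 1 - h], the two preceding bounds give a Jensen gap of at least
    [s h^2 / 4], while comparing the powers with [u^2] and [v^2] bounds the quotient by [8 h^2]. *)
Lemma powR1D_gap1 (R : realType) (s u v : R) :
  0 <= s -> s <= 1 -> 0 <= v -> v <= u -> u + v = 2 ->
  1 + s / 32 * ((u `^ (1 + s) - v `^ (1 + s)) ^+ 2 /
                (u `^ (1 + s) + v `^ (1 + s)))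
  <= (u `^ (1 + s) + v `^ (1 + s)) / 2.
Proof.
move=> s0 s1 v0 vu uv2; set h := (u - v) / 2.
have eu : u = 1 + h by rewrite /h; lra.
have ev : v = 1 - h by rewrite /h; lra.
have h01 : 0 <= h <= 1 by apply/andP; split; lra.
clearbody h.
have u0 : 0 <= u by lra.
have q2 : 1 + s <= 2 by lra.
have Uge := powR1D_ge s0 u0; have Vge := powR1D_ge s0 v0.
have := sqrt_pair_le h01; rewrite -eu -ev => sq.
have U2 : u `^ (1 + s) <= u ^+ 2.
  rewrite -powR_mulrn//; apply: ler_powR q2; lra.
have V2 : v ^+ 2 <= v `^ (1 + s).
  have [->|vn0] := eqVneq v 0; first by rewrite expr0n powR_ge0.
  rewrite -powR_mulrn//; apply: ger_powR q2.
  by rewrite lt_neqAle eq_sym vn0 v0 /=; lra.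
have UV : v `^ (1 + s) <= u `^ (1 + s).
  by apply: ge0_ler_powR; rewrite ?nnegrE//; lra.
have V0 : 0 <= v `^ (1 + s) by apply: powR_ge0.
move: (u `^ _) (v `^ _) Uge Vge U2 V2 UV V0 => U V Uge Vge U2 V2 UV V0.
have sh : 0 <= s * h ^+ 2 by rewrite mulr_ge0 ?sqr_ge0//; lra.
have UVge : 1 + s * h ^+ 2 / 4 <= (U + V) / 2 by nra.
apply: le_trans UVge; rewrite lerD2l.
have UV2 : (U - V) ^+ 2 <= 16 * h ^+ 2.
  have -> : 16 * h ^+ 2 = (4 * h) ^+ 2 by ring.
  rewrite ler_sqr ?nnegrE; [|lra|lra].
  have : U - V <= u ^+ 2 - v ^+ 2 by lra.
  by rewrite eu ev => H; nra.
have S2 : 2 <= U + V by nra.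
have : (U - V) ^+ 2 / (U + V) <= 8 * h ^+ 2.
  rewrite ler_pdivrMr; last lra.
  have := sqr_ge0 h; nra.
move=> H; have : s * ((U - V) ^+ 2 / (U + V)) <= s * (8 * h ^+ 2).
  by apply: ler_wpM2l => //; lra.
by move=> ?; lra.
Qed.

(** Both sides are homogeneous of degree [1 + s], so dividing by the mean reduces to mean 1. The
    extra term is the gain over Jensen that pays for perturbing the law. *)
Lemma powR1D_gap (R : realType) (s x y : R) : 0 <= s -> s <= 1 -> 0 <= x -> 0 <= y ->
  ((x + y) / 2) `^ (1 + s) +
    s / 32 * ((x `^ (1 + s) - y `^ (1 + s)) ^+ 2 /
                (x `^ (1 + s) + y `^ (1 + s)))
  <= (x `^ (1 + s) + y `^ (1 + s)) / 2.
Proof.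
move=> s0 s1; wlog yx : x y / y <= x => [hw x0 y0|].
  have [/hw|/ltW/hw] := leP y x; first exact.
  move=> /(_ y0 x0); rewrite (addrC y) (addrC (y `^ _) (x `^ _)).
  by rewrite -[(_ - _) ^+ 2]sqrrN opprB.
move=> x0 y0; have [m0|mn0] := eqVneq (x + y) 0.
  have [-> ->] : x = 0 /\ y = 0 by split; lra.
  by rewrite addr0 mul0r powR0 ?subr0 ?addr0 ?expr0n/= ?mul0r ?mulr0 ?addr0//; lra.
have m0 : 0 < (x + y) / 2 by rewrite divr_gt0// lt_neqAle eq_sym mn0 addr_ge0.
set m := (x + y) / 2 in m0 *.
have mm : m != 0 by rewrite gt_eqF.
have mK (z : R) : 0 <= z -> z `^ (1 + s) = m `^ (1 + s) * (z / m) `^ (1 + s).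
  have m0' := ltW m0; move=> z0; rewrite -powRM//; last by rewrite divr_ge0.
  by rewrite mulrCA divff// mulr1.
have ym0 : 0 <= y / m by rewrite divr_ge0// ltW.
have xy2 : x / m + y / m = 2 by rewrite -mulrDl /m invf_div mulrCA divff// mulr1.
have yxm : y / m <= x / m by rewrite ler_pM2r// invr_gt0.
have := powR1D_gap1 s0 s1 ym0 yxm xy2.
rewrite (mK _ x0) (mK _ y0).
have M0 : 0 < m `^ (1 + s) by exact: powR_gt0.
have Un0 : (x / m) `^ (1 + s) + (y / m) `^ (1 + s) != 0.
  rewrite gt_eqF// ltr_pwDl ?powR_ge0//; apply: powR_gt0; lra.
move: (m `^ _) ((x / m) `^ _) ((y / m) `^ _) M0 Un0 => M U V M0 Un0 H.
rewrite -mulrBr -mulrDr exprMn.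
rewrite [_ / (M * _)](_ : _ = M * ((U - V) ^+ 2 / (U + V))); last first.
  by field; rewrite Un0 gt_eqF.
by nra.
Qed.

(** If [q <= 2 b], then [2 a x >= p^2] and [4 b y >= q^2], and AM-GM applies; otherwise [2 y >= q]
    and the term [a y] suffices. *)
Lemma cross_term_le (R : realType) (a b p q x y : R) :
  0 <= a -> 0 <= p <= a -> 0 <= b -> 0 <= q ->
  0 <= x -> 0 <= y -> x * (a + (a - p)) = p ^+ 2 -> y * (b + (b + q)) = q ^+ 2 ->
  p * q / 4 <= b * x + a * y.
Proof.
move=> a0 /andP[p0 pa] b0 q0 x0 y0 hx hy.
have [qb|bq] := leP q (2 * b).
  have hx' : p ^+ 2 <= 2 * a * x by rewrite -hx; nra.
  have hy' : q ^+ 2 <= 4 * b * y by rewrite -hy; nra.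
  rewrite -ler_sqr ?nnegrE; [|nra|nra].
  have : p ^+ 2 * q ^+ 2 <= (2 * a * x) * (4 * b * y).
    by apply: ler_pM; rewrite ?sqr_ge0.
  have := sqr_ge0 (b * x - a * y).
  have : 0 <= (b * x) * (a * y) by rewrite !mulr_ge0.
  nra.
have qp : 0 < q by lra.
have hy' : q <= 2 * y.
  have : q * q <= 2 * y * q by rewrite -expr2 -hy; nra.
  by rewrite ler_pM2r.
have : p * q <= a * (2 * y) by apply: ler_pM.
have : 0 <= b * x by rewrite mulr_ge0.
nra.
Qed.

(** The left side is positive only if the differences have opposite signs; the pair whose first
    entry is larger then plays the role of [a] in [cross_term_le]. *)
Lemma mul_diff_le (R : realType) (a0 a1 b0 b1 : R) :
  0 <= a0 -> 0 <= a1 -> 0 <= b0 -> 0 <= b1 ->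
  - ((a0 - a1) * (b0 - b1)) / 4 <=
  b0 * ((a0 - a1) ^+ 2 / (a0 + a1)) + a0 * ((b0 - b1) ^+ 2 / (b0 + b1)).
Proof.
move=> ha0 ha1 hb0 hb1.
have frac (x y : R) : 0 <= x -> 0 <= y ->
    0 <= (x - y) ^+ 2 / (x + y) /\ (x - y) ^+ 2 / (x + y) * (x + y) = (x - y) ^+ 2.
  move=> x0 y0; split; first by rewrite divr_ge0 ?sqr_ge0 ?addr_ge0.
  have [xy0|xyn0] := eqVneq (x + y) 0; last by rewrite divfK.
  have [-> ->] : x = 0 /\ y = 0 by split; lra.
  by rewrite subr0 expr0n /= !mul0r.
have [x0 hx] := frac _ _ ha0 ha1; have [y0 hy] := frac _ _ hb0 hb1.
move: (_ / (a0 + a1)) (_ / (b0 + b1)) x0 y0 hx hy => x y x0 y0 hx hy.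
have rhs0 : 0 <= b0 * x + a0 * y by rewrite addr_ge0// mulr_ge0.
have [a01|a10] := leP a0 a1; have [b01|b10] := leP b0 b1.
- by nra.
- have H : (b0 - b1) * (a1 - a0) / 4 <= a0 * y + b0 * x.
    apply: cross_term_le => //; [apply/andP; split; lra|lra| |].
      by rewrite -hy; ring.
    by rewrite -(opprB a0) sqrrN -hx; ring.
  by apply: le_trans (le_trans H _); lra.
- have H : (a0 - a1) * (b1 - b0) / 4 <= b0 * x + a0 * y.
    apply: cross_term_le => //; [apply/andP; split; lra|lra| |].
      by rewrite -hx; ring.
    by rewrite -(opprB b0) sqrrN -hy; ring.
  by apply: le_trans (le_trans H _); lra.
- by nra.
Qed.

(** The perturbation adds [s / 256 * (A0 - A1) * (B0 - B1)] to the mean of the powers. The two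
    Jensen gains, each of weight [s / 64], absorb it by [mul_diff_le]; hence [256 = 64 * 4]. *)
Lemma two_point_ineq (R : realType) (s f0 f1 g0 g1 : R) :
  0 <= s -> s <= 1 -> 0 <= f0 -> 0 <= f1 -> 0 <= g0 -> 0 <= g1 ->
  ((((f0 + f1) / 2) * g0) `^ (1 + s) + (f0 * ((g0 + g1) / 2)) `^ (1 + s)) / 2 <=
  (1 / 2 + s / 256) * (f0 * g0) `^ (1 + s) +
  (1 / 4 - s / 256) * (f1 * g0) `^ (1 + s) +
  (1 / 4 - s / 256) * (f0 * g1) `^ (1 + s) + s / 256 * (f1 * g1) `^ (1 + s).
Proof.
move=> s0 s1 f00 f10 g00 g10.
have fb : 0 <= (f0 + f1) / 2 by rewrite divr_ge0 ?addr_ge0.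
have gb : 0 <= (g0 + g1) / 2 by rewrite divr_ge0 ?addr_ge0.
rewrite (powRM _ fb g00) (powRM _ f00 gb) (powRM _ f00 g00) (powRM _ f10 g00).
rewrite (powRM _ f00 g10) (powRM _ f10 g10).
have := powR1D_gap s0 s1 f00 f10; have := powR1D_gap s0 s1 g00 g10.
have := mul_diff_le (powR_ge0 f0 (1 + s)) (powR_ge0 f1 (1 + s))
                    (powR_ge0 g0 (1 + s)) (powR_ge0 g1 (1 + s)).
have := powR_ge0 f0 (1 + s); have := powR_ge0 g0 (1 + s).
move: (((f0 + f1) / 2) `^ _) (((g0 + g1) / 2) `^ _) => FB GB.
move: (f0 `^ _) (f1 `^ _) (g0 `^ _) (g1 `^ _) => A0 A1 B0 B1.
move: (_ / (A0 + A1)) (_ / (B0 + B1)) => x y hB hA h hG hF.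
have hF' : B0 * (FB + s / 32 * x) <= B0 * ((A0 + A1) / 2) by apply: ler_wpM2l.
have hG' : A0 * (GB + s / 32 * y) <= A0 * ((B0 + B1) / 2) by apply: ler_wpM2l.
have hs : s / 64 * (- ((A0 - A1) * (B0 - B1)) / 4) <= s / 64 * (B0 * x + A0 * y).
  by apply: ler_wpM2l => //; lra.
lra.
Qed.

(** * Randomized communication complexity of disjointness *)

Fixpoint words (N : nat) : seq (seq bool) :=
  if N is n.+1 then map (cons false) (words n) ++ map (cons true) (words n)
  else [:: [::]].

Lemma mem_words N s : (s \in words N) = (size s == N).
Proof.
elim: N s => [|N IH] [|x s] //=.
- by rewrite mem_cat; apply/negP => /orP[] /mapP[].
- have mem_cons y : (x :: s \in map (cons y) (words N)) = (x == y) && (s \in words N).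
    apply/mapP/andP => [[t tN [-> ->]]|[/eqP-> sN]]; first by rewrite eqxx.
    by exists s.
  by rewrite mem_cat !mem_cons eqSS -IH; case: x {mem_cons}; rewrite ?orbF.
Qed.

Section Expectation.
Variables (R : realType).
Implicit Types (w : bool -> bool -> R) (h : seq bool -> seq bool -> R).

Definition weight w (s t : seq bool) : R := \prod_(p <- zip s t) w p.1 p.2.

Definition expect w (N : nat) h : R :=
  \sum_(s <- words N) \sum_(t <- words N) weight w s t * h s t.

Lemma weight_ge0 w s t : (forall x y, 0 <= w x y) -> 0 <= weight w s t.
Proof. by move=> w0; apply: prodr_ge0. Qed.

Lemma expect0 w h : expect w 0 h = h [::] [::].
Proof. by rewrite /expect !big_seq1 /weight big_nil mul1r. Qed.

Lemma expectS w N h : expect w N.+1 h =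
  w false false * expect w N (fun s t => h (false :: s) (false :: t)) +
  w true false * expect w N (fun s t => h (true :: s) (false :: t)) +
  w false true * expect w N (fun s t => h (false :: s) (true :: t)) +
  w true true * expect w N (fun s t => h (true :: s) (true :: t)).
Proof.
rewrite {1}/expect /= big_cat !big_map /=.
have E x : \sum_(s <- words N) \sum_(t <- words N.+1)
      weight w (x :: s) t * h (x :: s) t =
    w x false * expect w N (fun s t => h (x :: s) (false :: t)) +
    w x true * expect w N (fun s t => h (x :: s) (true :: t)).
  rewrite /expect !mulr_sumr -big_split /=; apply: eq_bigr => s _.
  rewrite big_cat !big_map /= !mulr_sumr; congr +%R; apply: eq_bigr => t _;
  by rewrite /weight /= big_cons mulrA.
by rewrite !E /=; ring.
Qed.

Lemma le_expect w N h h' : (forall x y, 0 <= w x y) ->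
  (forall s t, size s = N -> size t = N -> h s t <= h' s t) ->
  expect w N h <= expect w N h'.
Proof.
move=> w0 hh; rewrite /expect big_seq_cond [leRHS]big_seq_cond.
apply: ler_sum => s; rewrite mem_words andbT => /eqP sN.
rewrite big_seq_cond [leRHS]big_seq_cond; apply: ler_sum => t.
rewrite mem_words andbT => /eqP tN.
by apply: ler_wpM2l; [exact: weight_ge0|exact: hh].
Qed.

Lemma eq_expect w N h h' :
  (forall s t, size s = N -> size t = N -> h s t = h' s t) ->
  expect w N h = expect w N h'.
Proof.
move=> hh; rewrite /expect big_seq_cond [RHS]big_seq_cond.
apply: eq_bigr => s; rewrite mem_words andbT => /eqP sN.
rewrite big_seq_cond [RHS]big_seq_cond; apply: eq_bigr => t.
by rewrite mem_words andbT => /eqP tN; rewrite hh.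
Qed.

Lemma expectD w N h h' :
  expect w N (fun s t => h s t + h' s t) = expect w N h + expect w N h'.
Proof.
rewrite /expect -big_split; apply: eq_bigr => s _ /=.
by rewrite -big_split; apply: eq_bigr => t _ /=; rewrite mulrDr.
Qed.

Lemma expectZ w N c h :
  expect w N (fun s t => c * h s t) = c * expect w N h.
Proof.
rewrite /expect mulr_sumr; apply: eq_bigr => s _ /=.
by rewrite mulr_sumr; apply: eq_bigr => t _ /=; rewrite mulrCA.
Qed.

Lemma expect_sum w N (I : finType) (h : I -> seq bool -> seq bool -> R) :
  expect w N (fun s t => \sum_i h i s t) = \sum_i expect w N (h i).
Proof.
rewrite /expect [RHS]exchange_big; apply: eq_bigr => s _ /=.
rewrite [RHS]exchange_big; apply: eq_bigr => t _ /=.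
by rewrite mulr_sumr.
Qed.

(* For [e = 0] this is the law of a disjoint pair of coordinates: one of the
   two, chosen at random, is 0 and the other is uniform.  For [e > 0] the
   pair (1, 1) has probability [e] and both marginals are unchanged. *)
Definition coin (e : R) (x y : bool) : R :=
  if x then if y then e else 1 / 4 - e else if y then 1 / 4 - e else 1 / 2 + e.

Lemma coin_ge0 e x y : 0 <= e -> e <= 1 / 4 -> 0 <= coin e x y.
Proof. by move=> e0 e4; rewrite /coin; case: x; case: y; lra. Qed.

Definition disjoint_words (s t : seq bool) :=
  ~~ has (fun p => p.1 && p.2) (zip s t).

Lemma expect1 e N : expect (coin e) N (fun _ _ => 1) = 1.
Proof. by elim: N => [|N IH]; rewrite ?expect0 ?expectS// !IH /coin /=; field. Qed.

Lemma expect_disjoint e N :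
  expect (coin e) N (fun s t => (disjoint_words s t)%:R) = (1 - e) ^+ N.
Proof.
elim: N => [|N IH]; first by rewrite expect0.
rewrite expectS /disjoint_words /= -/(disjoint_words _ _).
rewrite (_ : expect _ _ (fun _ _ => false%:R) = 0); last first.
  by rewrite /expect big1// => s _; rewrite big1// => t _; rewrite mulr0.
have {IH} := IH; rewrite /disjoint_words => ->.
by rewrite exprS /coin /=; field.
Qed.

(* For the indicators of the sides of a rectangle [Q], this is a linearized form
   of [mu_e Q >= mu_0 Q `^ (1 + s)], with [e = s / 256]: indeed
   [x `^ (1 + s) >= tau `^ s * (x - tau)] for every [x >= 0]. *)
Lemma expect_rect_powR (s tau : R) N (F G : seq bool -> R) :
  0 <= s -> s <= 1 -> 0 < tau ->
  (forall u, 0 <= F u) -> (forall u, 0 <= G u) ->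
  tau `^ s * (expect (coin 0) N (fun u v => F u * G v) - tau) <=
  expect (coin (s / 256)) N (fun u v => (F u * G v) `^ (1 + s)).
Proof.
move=> s0 s1 tau0; elim: N F G => [|N IH] F G F0 G0.
  rewrite !expect0; set x := F _ * G _.
  have x0 : 0 <= x by rewrite mulr_ge0.
  have [xtau|taux] := leP x tau.
    apply: (@le_trans _ _ 0); last exact: powR_ge0.
    by rewrite mulr_ge0_le0 ?powR_ge0// subr_le0.
  have xp : 0 < x by exact: lt_trans taux.
  rewrite powRD ?(gt_eqF xp) ?implybT// powRr1//.
  have tx : tau `^ s <= x `^ s by apply: ge0_ler_powR; rewrite ?nnegrE//; exact: ltW.
  have := powR_ge0 tau s => t0.
  apply: (@le_trans _ _ (tau `^ s * x)); first by rewrite ler_wpM2l//; lra.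
  by rewrite mulrC ler_wpM2l.
have coin256 x y : 0 <= coin (s / 256) x y by apply: coin_ge0; lra.
pose Fb u := (F (false :: u) + F (true :: u)) / 2.
pose Gb u := (G (false :: u) + G (true :: u)) / 2.
have Fb0 u : 0 <= Fb u by rewrite divr_ge0 ?addr_ge0.
have Gb0 u : 0 <= Gb u by rewrite divr_ge0 ?addr_ge0.
(* In [IH1] the first bit of the second word is forced to be 0 and that of the
   first word is uniform; in [IH2] the roles are exchanged. *)
have IH1 := IH Fb (fun u => G (false :: u)) Fb0 (fun _ => G0 _).
have IH2 := IH (fun u => F (false :: u)) Gb (fun _ => F0 _) Gb0.
apply: (@le_trans _ _ (expect (coin (s / 256)) N (fun u v => 2^-1 *
   ((Fb u * G (false :: v)) `^ (1 + s) + (F (false :: u) * Gb v) `^ (1 + s))))).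
  (* [coin 0] is the equal mixture of the two laws with one bit forced to 0, so averaging [IH1] and
     [IH2] gives the bound for [N.+1]. *)
  rewrite expectZ expectD expectS.
  apply: (@le_trans _ _ (2^-1 * (tau `^ s *
      (expect (coin 0) N (fun u v => Fb u * G (false :: v)) - tau) + tau `^ s *
      (expect (coin 0) N (fun u v => F (false :: u) * Gb v) - tau)))); last first.
    by rewrite ler_wpM2l ?lerD.
  have -> : (fun u v => Fb u * G (false :: v)) = fun u v =>
      2^-1 * (F (false :: u) * G (false :: v) + F (true :: u) * G (false :: v)).
    by apply/funext => u; apply/funext => v; rewrite /Fb; field.
  have -> : (fun u v => F (false :: u) * Gb v) = fun u v =>
      2^-1 * (F (false :: u) * G (false :: v) + F (false :: u) * G (true :: v)).
    by apply/funext => u; apply/funext => v; rewrite /Gb; field.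
  by rewrite !expectZ !expectD /coin; lra.
rewrite expectS -!expectZ -!expectD; apply: le_expect => // u v _ _.
rewrite /coin mulrC; apply: two_point_ineq => //.
Qed.

(** The accepting inputs with transcript [c] form a rectangle with indicators [F c] and [G c], since
    acceptance depends only on the first word and the transcript. Summing [expect_rect_powR] over
    [c] costs one [tau] per transcript. *)
Lemma expect_protocol (s tau : R) N (Tr : finType)
    (tr : seq bool -> seq bool -> Tr) (g : seq bool -> seq bool -> bool) :
  0 <= s -> s <= 1 -> 0 < tau ->
  (forall u v u' v', tr u v = tr u' v' -> tr u v' = tr u v) ->
  (forall u v v', tr u v = tr u v' -> g u v = g u v') ->
  tau `^ s * (expect (coin 0) N (fun u v => (g u v)%:R) - #|Tr|%:R * tau) <=
  expect (coin (s / 256)) N (fun u v => (g u v)%:R).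
Proof.
move=> s0 s1 tau0 trR trg.
pose F c u : R := (has (fun v => (tr u v == c) && g u v) (words N))%:R.
pose G c v : R := (has (fun u => tr u v == c) (words N))%:R.
have gE u v : size u = N -> size v = N ->
    (g u v)%:R = \sum_c F c u * G c v.
  move=> uN vN; rewrite (bigD1 (tr u v))//= big1 ?addr0 => [|c cn].
    rewrite /F /G -natrM mulnb; congr (nat_of_bool _)%:R.
    apply/idP/andP => [guv|[/hasP[v' _ /andP[/eqP e gv']] _]].
      split; apply/hasP; first by exists v; rewrite ?mem_words ?vN ?eqxx.
      by exists u; rewrite ?mem_words ?uN ?eqxx.
    by rewrite (trg _ _ _ (esym e)).
  rewrite /F /G -natrM mulnb; case: andP => //.
  move=> [/hasP[v' _ /andP[/eqP e _]] /hasP[u' _ /eqP e']].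
  by case/eqP: cn; rewrite -e (trR u v' u' v) ?e.
rewrite !(eq_expect _ gE) !expect_sum mulrBr mulr_sumr.
have -> : tau `^ s * (#|Tr|%:R * tau) = \sum_(c : Tr) tau `^ s * tau.
  by rewrite sumr_const -mulr_natl; ring.
rewrite -sumrB; apply: ler_sum => c _; rewrite -mulrBr.
apply: le_trans (expect_rect_powR N s0 s1 tau0 _ _) _ => //.
apply: le_expect => [x y|u v _ _]; first by apply: coin_ge0; lra.
have s1n0 : 1 + s != 0 by rewrite gt_eqF//; lra.
by rewrite /F /G; do 2 case: has; rewrite ?mulr0 ?mul0r ?mulr1 ?powR1 ?powR0.
Qed.

End Expectation.

(* Local computation being arbitrary, the behaviour of an algorithm need not be a
   measurable function of its tapes: only the success sets [S i] get integrated. *)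
Lemma sum_prob_le (R : realType) (d : measure_display) (T : measurableType d)
    (P : probability T R) (I : Type) (r : seq I) (k : I -> R) (S : I -> set T)
    (p K : R) :
  (forall i, 0 <= k i) -> (forall i, measurable (S i)) ->
  (forall i, (p%:E <= P (S i))%E) ->
  {ae P, forall w, \sum_(i <- r) k i * \1_(S i) w <= K} ->
  p * \sum_(i <- r) k i <= K.
Proof.
move=> k0 mS pS [N [mN N0 NK]].
(* A null set is not the whole space, so the bound holds at some point; this gives [0 <= K], which
   the comparison of integrals requires. *)
have [w Nw] : exists w, ~ N w.
  apply: contrapT => /forallNP H.
  have NT : N = setT by apply/seteqP; split=> // w _; apply: contrapT; exact: H.
  by move: N0; rewrite NT probability_setT => /eqP; rewrite onee_eq0.
have K0 : 0 <= K.
  have := contra_not (@NK w) Nw; rewrite /= => /contrapT; apply: le_trans.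
  by apply: sumr_ge0 => i _; rewrite mulr_ge0.
have f0 i x : (0 <= (k i * \1_(S i) x)%:E)%E by rewrite lee_fin mulr_ge0.
have mf i : measurable_fun setT (fun x => (k i * \1_(S i) x)%:E).
  apply/measurable_EFinP; apply: measurable_funM => //.
have : (\int[P]_(x in setT) (\sum_(i <- r) (k i * \1_(S i) x)%:E) <=
        \int[P]_(x in setT) K%:E)%E.
  apply: ae_ge0_le_integral => //.
  - by move=> x _; apply: sume_ge0.
  - exact: emeasurable_sum.
  exists N; split=> // x /= xK; apply: NK => /= H; apply: xK => _.
  by rewrite sumEFin lee_fin.
rewrite (ge0_integral_sum P measurableT mf (fun i x _ => f0 i x)).
rewrite integral_cst// (_ : _ setT = 1%E) ?mule1; last exact: probability_setT.
move=> H; rewrite -lee_fin; apply: le_trans H.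
rewrite mulr_sumr -sumEFin; apply: lee_sum => i _.
under eq_integral do rewrite EFinM.
rewrite ge0_integralZl_EFin//.
- rewrite integral_indic// setIT mulrC EFinM.
  by apply: lee_wpmul2l; [rewrite lee_fin|exact: pS].
- by apply/measurable_EFinP.
Qed.

(** The two properties of a deterministic two-player protocol that matter: inputs sharing a
    transcript form a rectangle, and the first player knows the answer from its own word and the
    transcript. *)
Definition is_rectangular (Tr : Type) (tr : seq bool -> seq bool -> Tr)
    (g : seq bool -> seq bool -> bool) : Prop :=
  (forall u v u' v', tr u v = tr u' v' -> tr u v' = tr u v) /\
  (forall u v v', tr u v = tr u v' -> g u v = g u v').

(** * Counting the transcripts of a protocol for disjointness *)

Section Disjointness.
Variables (R : realType) (d : measure_display) (T : measurableType d).
Variables (P : probability T R) (N : nat) (Tr : finType).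
Variables (tr : T -> seq bool -> seq bool -> Tr).
Variables (g : T -> seq bool -> seq bool -> bool).
Variables (S : seq bool -> seq bool -> set T).
Hypothesis mS : forall u v, measurable (S u v).
Hypothesis PS : forall u v, ((2 / 3)%:E <= P (S u v))%E.
Hypothesis Sg : {ae P, forall w, is_rectangular (tr w) (g w) /\
  forall u v, size u = N -> size v = N -> S u v w ->
    g w u v = disjoint_words u v}.

(* [44 * 64 = 11 * 256], so that [(s / 256) * N >= 11]. *)
Lemma disjointness_large (s : R) (M : nat) : (0 < M)%N -> (#|Tr| <= M)%N ->
  0 < s -> s <= 1 -> 44 * 64 <= s * N%:R -> s * ln (12 * M%:R) <= 1 / 4 -> False.
Proof.
move=> M0 TrM s0 s1 sN sM.
have s0' : 0 <= s by exact: ltW.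
have M0' : 0 < M%:R :> R by rewrite ltr0n.
(* All transcripts together then cost at most [1 / 12]. *)
pose tau : R := (12 * M%:R)^-1.
have tau0 : 0 < tau by rewrite invr_gt0 mulr_gt0.
have tauM : M%:R * tau = 12^-1 by rewrite /tau invfM mulrCA divff ?mulr1// gt_eqF.
pose e := s / 256.
have e0 : 0 <= e by rewrite /e; lra.
have e4 : e <= 1 / 4 by rewrite /e; lra.
have tau_s : 3 / 4 <= tau `^ s.
  rewrite /powR gt_eqF//; apply: le_trans (expR_ge1Dx _).
  by rewrite /tau lnV ?posrE ?mulr_gt0//; lra.
(* [(1 - e) (1 + e) <= 1], and [(1 + e)^N >= 1 + e N >= 12] by Bernoulli. *)
have disj_e : (1 - e) ^+ N <= 1 / 12.
  have : 11 <= e * N%:R by rewrite /e; lra.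
  move=> eN.
  have bern n : 1 + e * n%:R <= (1 + e) ^+ n.
    elim: n => [|n IH]; first by rewrite mulr0 addr0.
    rewrite exprS -natr1; apply: (@le_trans _ _ ((1 + e) * (1 + e * n%:R))).
      have := mulr_ge0 e0 (mulr_ge0 e0 (ler0n R n)).
      lra.
    by rewrite ler_wpM2l//; lra.
  have h1 : (1 - e) ^+ N * (1 + e) ^+ N <= 1.
    rewrite -exprMn; apply: exprn_ile1; nra.
  have h2 := bern N.
  have h3 : 0 <= (1 - e) ^+ N by apply: exprn_ge0; lra.
  have : (1 - e) ^+ N * 12 <= (1 - e) ^+ N * (1 + e) ^+ N by rewrite ler_wpM2l//; lra.
  lra.
(* Test weights: intersecting pairs are weighted by [mu_e], disjoint ones by [mu_0] scaled by the
   factor of [expect_protocol], so that the acceptance terms cancel. *)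
pose k (p : seq bool * seq bool) : R :=
  weight (coin e) p.1 p.2 * (~~ disjoint_words p.1 p.2)%:R +
  tau `^ s * (weight (coin 0) p.1 p.2 * (disjoint_words p.1 p.2)%:R).
pose r := [seq (u, v) | u <- words N, v <- words N].
have c0 x y : 0 <= coin (0 : R) x y by apply: coin_ge0; lra.
have ce x y : 0 <= coin e x y by apply: coin_ge0.
have k0 p : 0 <= k p by rewrite addr_ge0 ?mulr_ge0 ?powR_ge0 ?weight_ge0.
have kE (c : seq bool -> seq bool -> R) : \sum_(p <- r) k p * c p.1 p.2 =
    expect (coin e) N (fun u v => (~~ disjoint_words u v)%:R * c u v) +
    tau `^ s * expect (coin 0) N (fun u v => (disjoint_words u v)%:R * c u v).
  rewrite big_allpairs /expect mulr_sumr -big_split; apply: eq_bigr => u _ /=.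
  rewrite mulr_sumr -big_split; apply: eq_bigr => v _ /=.
  by rewrite /k /=; ring.
have sumk : \sum_(p <- r) k p = 1 - (1 - e) ^+ N + tau `^ s.
  have -> : \sum_(p <- r) k p = \sum_(p <- r) k p * 1.
    by apply: eq_bigr => p _; rewrite mulr1.
  rewrite (kE (fun _ _ => 1)).
  have h1 : expect (coin e) N (fun u v => (~~ disjoint_words u v)%:R * 1) +
      (1 - e) ^+ N = 1.
    rewrite -expect_disjoint -expectD -[RHS](expect1 e N); apply: eq_expect => u v _ _.
    by case: disjoint_words => /=; lra.
  have h2 : expect (coin (0 : R)) N (fun u v => (disjoint_words u v)%:R * 1) = 1.
    under [LHS]eq_expect do rewrite mulr1.
    by rewrite expect_disjoint subr0 expr1n.
  rewrite h2 mulr1; lra.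
(* With [sumk] and [disj_e] this bound would force the power of [tau] below [2 / 3], contrary to
   [tau_s]. *)
have : 2 / 3 * \sum_(p <- r) k p <= 1 + tau `^ s / 12; last by rewrite sumk; lra.
apply: (@sum_prob_le _ _ _ P _ r k (fun p => S p.1 p.2)) => //.
apply: filterS Sg => w [[trR trg] Sw].
rewrite (kE (fun u v => \1_(S u v) w)).
have := expect_protocol N s0' s1 tau0 trR trg; rewrite -/e.
have : #|Tr|%:R * tau <= 12^-1 by rewrite -tauM ler_pM2r// ler_nat.
have le1 : expect (coin e) N (fun u v => (g w u v)%:R) +
    expect (coin e) N (fun u v => (~~ disjoint_words u v)%:R * \1_(S u v) w) <= 1.
  rewrite -[leRHS](expect1 e N) -expectD; apply: le_expect => // u v uN vN.
  rewrite indicE; have [/set_mem Suv|_] := boolP (w \in S u v).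
    by rewrite Sw//; case: disjoint_words => /=; lra.
  by case: (g w u v); rewrite /=; lra.
have le2 : expect (coin 0) N (fun u v => (disjoint_words u v)%:R * \1_(S u v) w) <=
    expect (coin (0 : R)) N (fun u v => (g w u v)%:R).
  apply: le_expect => // u v uN vN.
  rewrite indicE; have [/set_mem Suv|_] := boolP (w \in S u v).
    by rewrite Sw// mulr1.
  by rewrite mulr0.
have t0 := powR_ge0 tau s.
move=> Tt H.
have h1 := ler_wpM2l t0 le2.
have h2 := ler_wpM2l t0 Tt.
lra.
Qed.

(** A single transcript gives the all-ones word the same answer against all zeros and all ones, so
    the two success sets are almost surely disjoint; yet their probabilities add up to at least
    [4 / 3]. *)
Lemma disjointness_trivial : (0 < N)%N -> (#|Tr| <= 1)%N -> False.
Proof.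
move=> N0 /fintype_le1P Tr1.
pose one := nseq N true; pose zero := nseq N false.
have dz : disjoint_words one zero.
  by rewrite /disjoint_words /one /zero; elim: (N).
have d1 : disjoint_words one one = false.
  by rewrite /disjoint_words /one; case: (N) N0.
have : (2 / 3 : R) * \sum_(v <- [:: zero; one]) 1 <= 1; last first.
  by rewrite !big_cons big_nil; lra.
apply: (@sum_prob_le _ _ _ P _ _ _ (fun v => S one v)) => //.
apply: filterS Sg => w [[_ trg] Sw].
rewrite !big_cons big_nil addr0 !mul1r !indicE.
have gE : g w one zero = g w one one.
  by apply: trg; exact: Tr1.
have [/set_mem S0|_] := boolP (w \in S one zero); last first.
  by case: (w \in S one one) => /=; lra.
have [/set_mem S1|_] := boolP (w \in S one one); last by rewrite /=; lra.
by move: gE; rewrite !Sw ?size_nseq// dz d1.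
Qed.

End Disjointness.

Definition disj_rate (R : realType) : R := (64 * 64 * 64 * 64)^-1.

Lemma disj_rate_gt0 (R : realType) : 0 < disj_rate R.
Proof. by rewrite invr_gt0 mulr_gt0. Qed.

(** Two transcripts already have logarithm at least [1 / 2], so a failure of the bound forces [N] to
    be large; then [s = 44 * 64 / N] is at most 1 and [disjointness_large] applies. *)
Lemma disjointness_lower_bound (R : realType) (d : measure_display)
    (T : measurableType d) (P : probability T R) (N : nat) (Tr : finType)
    (tr : T -> seq bool -> seq bool -> Tr)
    (g : T -> seq bool -> seq bool -> bool)
    (S : seq bool -> seq bool -> set T) :
  (forall u v, measurable (S u v)) ->
  (forall u v, ((2 / 3)%:E <= P (S u v))%E) ->
  {ae P, forall w, is_rectangular (tr w) (g w) /\
    forall u v, size u = N -> size v = N -> S u v w ->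
      g w u v = disjoint_words u v} ->
  (0 < N)%N -> (0 < #|Tr|)%N -> disj_rate R * N%:R < ln #|Tr|%:R.
Proof.
move=> mS PS Sg N0 Tr0; rewrite ltNge; apply/negP => lnTr.
have [Tr1|Tr2] := leqP #|Tr| 1; first exact: (disjointness_trivial mS PS Sg).
set M : R := #|Tr|%:R in lnTr.
have M2 : 2 <= M by rewrite /M ler_nat.
have ln2 : 1 / 2 <= ln M.
  have := @le_ln1Dx R (M^-1 - 1); rewrite addrCA subrr addr0 lnV ?posrE; last lra.
  have Mi : M^-1 <= 2^-1 by rewrite lef_pV2 ?posrE//; lra.
  have Mi0 : 0 < M^-1 by rewrite invr_gt0; lra.
  by move=> H; have := H _; lra.
have Npos : 0 < N%:R :> R by rewrite ltr0n.
have Nn0 : N%:R != 0 :> R by rewrite gt_eqF.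
have big : (64 * 64 * 64 * 32 : R) <= N%:R.
  have := le_trans ln2 lnTr; rewrite /disj_rate => H.
  have : (64 * 64 * 64 * 64 : R) * (1 / 2) <=
    (64 * 64 * 64 * 64) * ((64 * 64 * 64 * 64)^-1 * N%:R).
    by rewrite ler_pM2l// mulr_gt0.
  by rewrite mulrA divff ?mul1r ?gt_eqF ?mulr_gt0//; lra.
apply: (@disjointness_large R d T P N Tr tr g S mS PS Sg ((44 * 64) / N%:R) #|Tr|) => //.
- by rewrite divr_gt0.
- by rewrite ler_pdivrMr//; lra.
- by rewrite divfK.
rewrite lnM ?posrE//; last lra.
have ln12 : ln (12 : R) < 12 by apply: ln_sublinear.
have s0 : 0 <= (44 * 64) / N%:R :> R by rewrite divr_ge0.
have sN : (44 * 64) / N%:R * N%:R = (44 * 64) :> R by rewrite divfK.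
move: ((44 * 64) / N%:R) s0 sN => s s0 sN.
have h1 : s * ln 12 <= s * 12 by rewrite ler_wpM2l// ltW.
have h2 : s * ln M <= s * (disj_rate R * N%:R) by rewrite ler_wpM2l.
have h3 : s * (64 * 64 * 64 * 32) <= s * N%:R by rewrite ler_wpM2l.
have h4 : s * (disj_rate R * N%:R) = (44 * 64) * disj_rate R by rewrite mulrCA sN mulrC.
have h5 : disj_rate R * (64 * 64 * 64 * 64) = 1 by rewrite mulVf// gt_eqF// mulr_gt0.
lra.
Qed.

(** * Splicing executions *)

Section Splice.
Variables (A : algorithm) (d n : nat).
Implicit Types (K G : network d n) (st : 'I_n -> state A).

Lemma message_eq K G st st' u v : id_of K = id_of G -> st u = st' u ->
  message K st u v = message G st' u v.
Proof. by rewrite /message => -> ->. Qed.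

Lemma round_local K G st st' v : id_of K = id_of G ->
  (forall u, linked K u v = linked G u v) -> st v = st' v ->
  (forall u, linked K u v -> message K st u v = message G st' u v) ->
  round K st v = round G st' v.
Proof.
move=> idE lE stE mE; rewrite /round stE; congr (if _ then _ else step _ _).
apply/funext => i; rewrite /inbox.
rewrite (@eq_pick _ _ [pred u | linked G u v && (id_of G u == i)]); last first.
  by move=> u; rewrite /= lE idE.
by case: pickP => // u /andP[lu _]; apply: mE; rewrite lE.
Qed.

Lemma input_of_local K G v : id_of K = id_of G ->
  (forall u, ((u, v) \in edges K) = ((u, v) \in edges G)) ->
  (forall u, ((v, u) \in edges K) = ((v, u) \in edges G)) ->
  input_of K v = input_of G v.
Proof.
move=> idE eI eO; rewrite /input_of idE; congr LocalInput; apply/fsetP => i.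
- by apply/imfsetP/imfsetP => -[u /=]; rewrite !inE => uE ->; exists u;
    rewrite // inE /= ?eO// -eO.
- by apply/imfsetP/imfsetP => -[u /=]; rewrite !inE => uE ->; exists u;
    rewrite // inE /= ?eI// -eI.
Qed.

(** By induction on the rounds, a vertex of [S] sees in [K] what it sees in [G], and any other
    vertex what it sees in [G']: edges across the cut exist in all three networks alike and carry
    equal messages in [G] and [G']. *)
Lemma run_splice K G G' (S : pred 'I_n) (r : 'I_n -> tape) (T : nat) :
  id_of K = id_of G -> id_of K = id_of G' ->
  (forall u v, S u || S v -> ((u, v) \in edges K) = ((u, v) \in edges G)) ->
  (forall u v, ~~ S u || ~~ S v -> ((u, v) \in edges K) = ((u, v) \in edges G')) ->
  (forall t u v, (t < T)%N -> S u != S v -> linked K u v ->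
     message G (run A G r t) u v = message G' (run A G' r t) u v) ->
  forall t, (t <= T)%N -> forall v,
    run A K r t v = if S v then run A G r t v else run A G' r t v.
Proof.
move=> idG idG' eG eG' eqm; elim=> [|t IH] tT v.
  rewrite /run /=; case: ifPn => Sv; congr init; apply: input_of_local => // u.
  - by rewrite eG// Sv orbT.
  - by rewrite eG// Sv.
  - by rewrite eG'// Sv orbT.
  - by rewrite eG'// Sv.
rewrite /run !iterS -!/(run _ _ _ _); have {}IH := IH (ltnW tT).
case: ifPn => Sv; apply: round_local => //.
- by move=> u; rewrite /linked !eG// Sv ?orbT.
- by rewrite IH Sv.
- move=> u lu; have [Su|Su] := boolP (S u).
    by apply: message_eq => //; rewrite IH Su.
  rewrite eqm ?(negbTE Su) ?Sv//.
  by apply: message_eq => //; rewrite IH (negbTE Su).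
- by move=> u; rewrite /linked !eG'// Sv ?orbT.
- by rewrite IH (negbTE Sv).
- move=> u lu; have [Su|Su] := boolP (S u); last first.
    by apply: message_eq => //; rewrite IH (negbTE Su).
  rewrite -eqm ?Su ?(negbTE Sv)//.
  by apply: message_eq => //; rewrite IH Su.
Qed.

Lemma run_halted G (r : 'I_n -> tape) (t t' : nat) :
  all_halted A G r t -> (t <= t')%N -> run A G r t' = run A G r t.
Proof.
move=> h /subnKC <-; elim: (t' - t)%N => [|i IH]; first by rewrite addn0.
rewrite addnS /run iterS -/(run _ _ _ _) IH; apply/funext => v.
by rewrite /round h.
Qed.

End Splice.

(** * The gadget *)

Lemma disjoint_wordsP (s t : seq bool) : size s = size t ->
  reflect (forall m, (m < size s)%N -> ~~ (nth false s m && nth false t m))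
    (disjoint_words s t).
Proof.
rewrite /disjoint_words; elim: s t => [|x s IH] [|y t] //= => [_|[/IH{}IH]].
  by apply: (iffP idP).
rewrite negb_or; apply: (iffP andP) => [[xy /IH H] [|m]//|H]; first exact: H.
by split; [exact: (H 0)|apply/IH => m; exact: (H m.+1)].
Qed.

Section Gadget.
Local Open Scope nat_scope.
Variables (d n l b : nat).
Hypotheses (d_gt0 : 0 < d) (l_gt0 : 0 < l) (n_ge : (b + b).+4 * l <= n).
Implicit Types (u v : 'I_n) (s t : seq bool).

(* The vertex [v] lies in row [v %% l] of layer [v %/ l].  Layers 0 to 3 are
   the hubs x, y, x', y'; the next [b] layers are the sources U, the next [b]
   ones the targets V; the remaining vertices are isolated. *)
Definition is_source (q : nat) : bool := 4 <= q < b.+4.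
Definition is_target (q : nat) : bool := b.+4 <= q < (b + b).+4.
Definition bit s (i j : nat) : bool := nth false s (i * l + j).

Definition layer_edge s t (q i q' i' : nat) : bool :=
  [|| is_source q && is_target q',
      [&& is_source q, q' == 0 & i == i'],
      [&& q == 1, is_target q' & i == i'],
      [&& q == 0, q' == 1 & ~~ bit s i i'],
      [&& q == 0, q' == 2 & i == i'],
      [&& q == 2, q' == 3 & ~~ bit t i i'] |
      [&& q == 3, q' == 1 & i == i']].

Definition gadget_edges s t : digraph n :=
  [set e : 'I_n * 'I_n |
     layer_edge s t (e.1 %/ l) (e.1 %% l) (e.2 %/ l) (e.2 %% l)].

Lemma gadget_loopless s t v : (v, v) \notin gadget_edges s t.
Proof.
rewrite inE /layer_edge /is_source /is_target /=.
by case: (v %/ l) => [|[|[|[|q]]]] //=; rewrite (leqNgt b.+4 q.+4); case: ltnP.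
Qed.

Lemma ord_lt_exp v : v < n ^ d.
Proof.
apply: leq_trans (ltn_ord v) _; rewrite -{1}(expn1 n) leq_pexp2l//.
by apply: leq_ltn_trans (ltn_ord v).
Qed.

Definition gadget s t : network d n :=
  Network (gadget_loopless s t) (@ord_inj n) ord_lt_exp.

Lemma vertex_subproof (k : nat) (i : 'I_l) :
  (inord k : 'I_(b + b).+4) * l + i < n.
Proof.
apply: leq_trans n_ge; apply: (@leq_trans ((inord k : 'I_(b + b).+4).+1 * l)).
  by rewrite mulSn addnC ltn_add2r.
by rewrite leq_mul2r ltn_ord orbT.
Qed.

(** [inord] only makes this total: it is the identity on the layers [k < (b + b).+4]. *)
Definition vertex (k : nat) (i : 'I_l) : 'I_n := Ordinal (vertex_subproof k i).

Lemma vertex_div k i : k < (b + b).+4 -> vertex k i %/ l = k.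
Proof. by move=> kb; rewrite /= inordK// divnMDl// divn_small ?addn0. Qed.

Lemma vertex_mod k i : vertex k i %% l = i.
Proof. by rewrite /= modnMDl modn_small. Qed.

Lemma eq_vertex u v : u %/ l = v %/ l -> u %% l = v %% l -> u = v.
Proof.
by move=> q r; apply: val_inj; rewrite /= (divn_eq u l) (divn_eq v l) q r.
Qed.

Definition row u : 'I_l := Ordinal (ltn_pmod u l_gt0).

Lemma vertexK u k : u %/ l = k -> k < (b + b).+4 -> vertex k (row u) = u.
Proof. by move=> uk kb; apply: eq_vertex; rewrite ?vertex_div ?vertex_mod. Qed.

(** The second player simulates the hubs x' and y', between which lie all edges depending on [t];
    those depending on [s] join two vertices of the first player. *)
Definition bob v : bool := (v %/ l == 2) || (v %/ l == 3).

Lemma gadget_alice s t t' u v : ~~ bob u || ~~ bob v ->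
  ((u, v) \in gadget_edges s t) = ((u, v) \in gadget_edges s t').
Proof.
rewrite !inE /layer_edge /bob /=.
move: (u %/ l) (v %/ l) => q q'; case: (q =P 2) => [->|]; case: (q' =P 3) => [->|] //=.
Qed.

Lemma gadget_bob s s' t u v : bob u || bob v ->
  ((u, v) \in gadget_edges s t) = ((u, v) \in gadget_edges s' t).
Proof.
rewrite !inE /layer_edge /bob /=.
move: (u %/ l) (v %/ l) => q q'; case: (q =P 0) => [->|]; case: (q' =P 1) => [->|] //=.
Qed.

Lemma gadget_to_bob s t u v : (u, v) \in gadget_edges s t -> ~~ bob u -> bob v ->
  [/\ u %/ l = 0, v %/ l = 2 & u %% l = v %% l].
Proof.
rewrite inE /layer_edge /bob /is_target /= => uv bu bv; move: bv uv bu.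
case/orP => /eqP->; rewrite /= !andbF /= ?andbF ?orbF.
  by move=> /andP[/eqP-> /eqP->].
by move=> /andP[/eqP->].
Qed.

Lemma gadget_from_bob s t u v : (u, v) \in gadget_edges s t -> bob u -> ~~ bob v ->
  [/\ u %/ l = 3, v %/ l = 1 & u %% l = v %% l].
Proof.
rewrite inE /layer_edge /bob /is_source /= => uv bu bv; move: bu uv bv.
case/orP => /eqP->; rewrite /= ?orbF.
  by move=> /andP[/eqP->].
by move=> /andP[/eqP-> /eqP->].
Qed.

(** The cut joins x to x' and y to y' within a row; [c], read as a number, selects the layers 0 and
    2 or 1 and 3. *)
Lemma gadget_cut s t u v : bob u != bob v -> linked (gadget s t) u v ->
  exists (i : 'I_l) (c : bool),
    (u = vertex c i /\ v = vertex c.+2 i) \/ (u = vertex c.+2 i /\ v = vertex c i).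
Proof.
wlog: u v / bob v => [hw|bv].
  case bv: (bob v); first by rewrite -{1}bv; exact: hw.
  case bu: (bob u) => // _; rewrite /linked orbC => luv.
  have [||i [c [[-> ->]|[-> ->]]]] := hw v u bu; rewrite ?bu ?bv//.
    by exists i, c; right.
  by exists i, c; left.
rewrite bv eqb_id => bu luv; exists (row u).
have eqv (k : bool) : u %/ l = k -> v %/ l = k.+2 -> u %% l = v %% l ->
    u = vertex k (row u) /\ v = vertex k.+2 (row u).
  by move=> qu qv r; split; apply: eq_vertex; rewrite ?vertex_div ?vertex_mod//;
    case: (k).
case/orP: luv => e.
  by have [q q' r] := gadget_to_bob e bu bv; exists false; left; exact: eqv.
by have [q q' r] := gadget_from_bob e bv bu; exists true; left; apply: eqv.
Qed.

Lemma linked_cut s t s' t' u v : bob u != bob v ->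
  linked (gadget s t) u v = linked (gadget s' t') u v.
Proof.
move=> uv; have [b1 b2] : (bob u || bob v) /\ (~~ bob u || ~~ bob v).
  by move: uv; do 2 case: bob.
rewrite /linked /=; congr (_ || _).
  by rewrite (gadget_alice s t t' b2) (gadget_bob s s' t' b1).
rewrite orbC in b1; rewrite orbC in b2.
by rewrite (gadget_alice s t t' b2) (gadget_bob s s' t' b1).
Qed.

Definition dense : digraph n :=
  [set e : 'I_n * 'I_n | is_source (e.1 %/ l) && is_target (e.2 %/ l)].

Lemma dense_sub s t : dense \subset gadget_edges s t.
Proof. by apply/fintype.subsetP => e; rewrite !inE /layer_edge => ->. Qed.

Lemma dense_alice e : e \in dense -> ~~ bob e.1 /\ ~~ bob e.2.
Proof.
rewrite inE /is_source /is_target /bob; move: (e.1 %/ l) (e.2 %/ l) => q q'.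
move=> /andP[/andP[q4 _] /andP[q4' _]]; have {}q4' : 3 < q' by apply: leq_trans q4'.
by split; rewrite negb_or; apply/andP; split; rewrite gtn_eqF// ltnW.
Qed.

(** * The two-player protocol induced by an execution *)

Section Transcript.
Variables (A : algorithm) (r : 'I_n -> tape) (T L : nat).
Hypothesis short_message : forall s t (i : nat) u v, linked (gadget s t) u v ->
  size (message (gadget s t) (run A (gadget s t) r i) u v) <= L.

(** Padding with [None] puts all messages of at most [L] bits into one finite type without losing
    their lengths. *)
Definition encode (m : seq bool) : {ffun 'I_L -> option bool} :=
  [ffun i : 'I_L => nth None (map Some m) i].

Lemma encode_inj m m' : size m <= L -> size m' <= L ->
  encode m = encode m' -> m = m'.
Proof.
move=> mL mL' /ffunP E.
have {E} : forall i, nth None (map Some m) i = nth None (map Some m') i.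
  move=> i; have [iL|Li] := ltnP i L; first by have := E (Ordinal iL); rewrite !ffunE.
  by rewrite !nth_default// size_map (leq_trans _ Li).
elim: m m' {mL mL'} => [|x m IH] [|y m'] E //; try by have := E 0.
by have [-> ] := E 0; congr cons; apply: IH => i; exact: (E i.+1).
Qed.

Definition transcript s t :
    {ffun 'I_T * ('I_l * bool * bool) -> {ffun 'I_L -> option bool}} :=
  [ffun x : 'I_T * ('I_l * bool * bool) => let: (i, (j, c, to_bob)) := x in
    encode (message (gadget s t) (run A (gadget s t) r i)
      (vertex (if to_bob then c : nat else c.+2) j)
      (vertex (if to_bob then c.+2 else c : nat) j))].

Lemma transcript_message s t s' t' : transcript s t = transcript s' t' ->
  forall i u v, i < T -> bob u != bob v -> linked (gadget s t) u v ->
  message (gadget s t) (run A (gadget s t) r i) u v =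
  message (gadget s' t') (run A (gadget s' t') r i) u v.
Proof.
move=> /ffunP E i u v iT uv luv; apply: encode_inj.
- exact: short_message.
- by apply: short_message; rewrite (linked_cut s' t' s t uv).
have [j [c [[-> ->]|[-> ->]]]] := gadget_cut uv luv.
  by have := E (Ordinal iT, (j, c, true)); rewrite !ffunE.
by have := E (Ordinal iT, (j, c, false)); rewrite !ffunE.
Qed.

Lemma run_gadget s t s' t' : transcript s t = transcript s' t' ->
  forall i, i <= T -> forall v, run A (gadget s t') r i v =
    if ~~ bob v then run A (gadget s t) r i v else run A (gadget s' t') r i v.
Proof.
move=> E; apply: run_splice => //.
- by move=> u v; apply: gadget_alice.
- by move=> u v; rewrite !negbK; apply: gadget_bob.
move=> i u v iT; rewrite (inj_eq negb_inj) => uv luv.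
by apply: transcript_message => //; rewrite (linked_cut s t s t' uv).
Qed.

(** Dense edges have both endpoints on the first player's side, so that player can count those in
    the output. *)
Definition accepts s t : bool :=
  #|output_graph A (gadget s t) r T :&: dense| < b * b.

Lemma transcript_rectangular : is_rectangular transcript accepts.
Proof.
split=> [s t s' t' E|s t t' E].
  have R := run_gadget E; apply/ffunP => -[i [[j c] dir]]; rewrite !ffunE.
  have iT := ltnW (ltn_ord i).
  have /ffunP /(_ (i, (j, c, dir))) := E; rewrite !ffunE => Em.
  set u := vertex (if dir then _ else _) j in Em *; set v := vertex _ j in Em *.
  (* On input [(s, t')] the sender is in its state on [(s, t)] or on [(s', t')], according to its
     side; both send the same message. *)
  have [bu|bu] := boolP (bob u); last first.
    have Ru : run A (gadget s t') r i u = run A (gadget s t) r i u.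
      by rewrite (R i iT u) bu.
    by rewrite (@message_eq _ _ _ (gadget s t') (gadget s t) _ _ _ v erefl Ru).
  have Ru : run A (gadget s t') r i u = run A (gadget s' t') r i u.
    by rewrite (R i iT u) bu.
  by rewrite (@message_eq _ _ _ (gadget s t') (gadget s' t') _ _ _ v erefl Ru) Em.
suff oE : output_graph A (gadget s t) r T :&: dense =
    output_graph A (gadget s t') r T :&: dense by rewrite /accepts oE.
apply/setP => e; rewrite [LHS]finset.in_setI [RHS]finset.in_setI.
have [ed|] := boolP (e \in dense); last by rewrite !andbF.
have [e1 e2] := dense_alice ed.
have R v : ~~ bob v -> run A (gadget s t') r T v = run A (gadget s t) r T v.
  by move=> bv; rewrite (run_gadget E (leqnn T) v) bv.
rewrite !andbT [LHS]finset.in_set [RHS]finset.in_set.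
rewrite (fintype.subsetP (dense_sub s t) e ed) (fintype.subsetP (dense_sub s t') e ed).
by rewrite (R _ e1) (R _ e2).
Qed.

End Transcript.


(** * Spanners of the gadget *)

Lemma layer_edge_source s t q r q' r' : is_source q -> ~~ is_target q' ->
  layer_edge s t q r q' r' -> q' = 0 /\ r = r'.
Proof.
rewrite /layer_edge => sq /negbTE->; rewrite sq /=.
case: q sq => [|[|[|[|q]]]]//= _; rewrite !orbF => /andP[/eqP-> /eqP->] //.
Qed.

Lemma layer_edge_target s t q r q' r' : is_target q -> layer_edge s t q r q' r' = false.
Proof.
rewrite /layer_edge /is_source => /andP[bq _]; rewrite (ltnNge q b.+4) bq andbF.
by case: q bq => [|[|[|[|q]]]].
Qed.

Lemma sparse_edge s t u v :
  layer_edge s t (u %/ l) (u %% l) (v %/ l) (v %% l) ->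
  ~~ (is_source (u %/ l) && is_target (v %/ l)) ->
  (u, v) \in gadget_edges s t :\: dense.
Proof. by move=> uv nd; rewrite !inE /= nd. Qed.

(** A dense edge from row i to row j is replaced by the path through x_i, y_j of length 3, or by the
    one through x_i, x'_i, y'_j, y_j of length 5. *)
Lemma disjoint_spanner k s t : 5 <= k -> size s = l * l -> size t = l * l ->
  disjoint_words s t -> is_spanner k (gadget_edges s t) (gadget_edges s t :\: dense).
Proof.
move=> k5 sl tl /disjoint_wordsP; rewrite sl tl => /(_ erefl) disj.
split=> [|u v uv]; first exact: subsetDl.
have [uvd|uvd] := boolP ((u, v) \in dense); last first.
  exists [:: v]; split=> //=; last exact: leq_trans k5.
  by rewrite andbT finset.in_setD uvd.
move: uvd; rewrite finset.in_set /= => /andP[su tv].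
have mlt : row u * l + row v < l * l.
  apply: (@leq_trans ((row u).+1 * l)); first by rewrite mulSn addnC ltn_add2r.
  by rewrite leq_mul2r ltn_ord orbT.
have edge0 : (u, vertex 0 (row u)) \in gadget_edges s t :\: dense.
  apply: sparse_edge; rewrite vertex_div// ?vertex_mod /layer_edge.
    by rewrite su !eqxx orbT.
  by rewrite andbF.
have edge1 : (vertex 1 (row v), v) \in gadget_edges s t :\: dense.
  by apply: sparse_edge; rewrite vertex_div// ?vertex_mod /layer_edge ?tv ?eqxx ?orbT.
have := disj _ mlt; rewrite negb_and => /orP[bs|bt].
- exists [:: vertex 0 (row u); vertex 1 (row v); v]; split=> //=; last first.
    exact: leq_trans k5.
  rewrite edge0 edge1 !andTb !andbT; apply: sparse_edge; rewrite !vertex_div// !vertex_mod.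
  by rewrite /layer_edge /bit bs.
- exists [:: vertex 0 (row u); vertex 2 (row u); vertex 3 (row v);
             vertex 1 (row v); v]; split=> //=.
  rewrite edge0 edge1 !andTb !andbT; apply/and3P; split; apply: sparse_edge;
    rewrite !vertex_div// !vertex_mod /layer_edge ?eqxx//.
  by rewrite /bit bt.
Qed.

(** Except for the hub edges x to y and x' to y', at most [2 l^2] in number, every sparse edge is
    determined by its first endpoint or, if it enters a target, by its second. *)
Lemma card_sparse s t : #|gadget_edges s t :\: dense| <= 2 * (n + l * l).
Proof.
pose first_determined := [set e in gadget_edges s t :\: dense |
   [|| is_source (e.1 %/ l), (e.1 %/ l == 0) && (e.2 %/ l == 2) | e.1 %/ l == 3]].
pose second_determined := [set e in gadget_edges s t :\: dense | is_target (e.2 %/ l)].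
pose hub (x : bool * 'I_l * 'I_l) : 'I_n * 'I_n :=
  (vertex (if x.1.1 then 0 else 2) x.1.2, vertex (if x.1.1 then 1 else 3) x.2).
have sub : gadget_edges s t :\: dense \subset
    first_determined :|: second_determined :|: (hub @: [set: bool * 'I_l * 'I_l]).
  apply/fintype.subsetP => -[u v] uv; rewrite finset.in_setU finset.in_setU.
  rewrite [_ \in first_determined]finset.in_set [_ \in second_determined]finset.in_set.
  rewrite uv /=; move: uv; rewrite !inE /layer_edge /= => /andP[/negbTE->] /=.
  have hubE (c : bool) : u %/ l = (if c then 0 else 2) ->
      v %/ l = (if c then 1 else 3) -> (u, v) \in hub @: [set: bool * 'I_l * 'I_l].
    move=> qu qv; apply/imsetP; exists (c, row u, row v) => //.
    by rewrite /hub /= !vertexK//; case: (c).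
  case/or4P => [/and3P[-> _ _]//|/and3P[_ -> _]|/and3P[/eqP q /eqP q' _]|].
  - by rewrite orbT.
  - by rewrite (hubE true)// !orbT.
  case/or3P => [/and3P[-> -> _]|/and3P[/eqP q /eqP q' _]|/and3P[-> _ _]].
  - by rewrite orbT.
  - by rewrite (hubE false)// !orbT.
  - by rewrite !orbT.
have c1 : #|first_determined| <= n.
  pose succ_layer q := if q == 0 then 2 else if q == 3 then 1 else 0.
  have det e : e \in first_determined ->
      e.2 %/ l = succ_layer (e.1 %/ l) /\ e.2 %% l = e.1 %% l.
    rewrite !inE /= => /andP[/andP[nd eE]] /or3P[su|/andP[/eqP q /eqP q']|/eqP q].
    - rewrite su /= in nd; have [-> ->] := layer_edge_source su nd eE; split=> //.
      by move: su; move: (_ %/ l) => k; rewrite /is_source; case: k => [|[|[|[|k]]]].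
    - by move: eE; rewrite /layer_edge q q' /= orbF => /eqP->.
    - by move: eE; rewrite /layer_edge q /= => /andP[/eqP-> /eqP->].
  rewrite -(@card_in_imset _ _ fst) => [|[u v] [u' v'] /det/= [q r] /det/= [q' r'] uu'].
    by rewrite -[X in _ <= X](card_ord n) max_card.
  by rewrite -uu' in q' r' *; congr pair; apply: eq_vertex; rewrite ?q ?q' ?r ?r'.
have c2 : #|second_determined| <= n.
  have det e : e \in second_determined -> e.1 %/ l = 1 /\ e.1 %% l = e.2 %% l.
    rewrite !inE /= => /andP[/andP[nd eE]] te; rewrite te andbT in nd.
    move: eE; rewrite /layer_edge (negbTE nd) /= te /=.
    case: (e.2 %/ l) te => [|[|[|[|q]]]] //= _.
    by rewrite !andbF !orbF => /andP[/eqP-> /eqP->].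
  rewrite -(@card_in_imset _ _ snd) => [|[u v] [u' v'] /det/= [q r] /det/= [q' r'] vv'].
    by rewrite -[X in _ <= X](card_ord n) max_card.
  by rewrite -vv' in q' r' *; congr pair; apply: eq_vertex; rewrite ?q ?q' ?r ?r'.
have c3 : #|hub @: [set: bool * 'I_l * 'I_l]| <= 2 * (l * l).
  apply: leq_trans (leq_imset_card _ _) _.
  by rewrite cardsT !card_prod card_bool card_ord mulnA.
apply: leq_trans (subset_leq_card sub) _.
apply: leq_trans (leq_card_setU _ _) _; rewrite mulnDr leq_add//.
by apply: leq_trans (leq_card_setU _ _) _; rewrite mul2n -addnn leq_add.
Qed.

(* Every vertex reachable from row [i] of the hub layer x satisfies [trapped],
   but no target in row [j] does. *)
Definition trapped (i j q r : nat) : bool :=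
  ((q == 0) || (q == 2)) && (r == i) ||
  [|| q == 1, q == 3 | is_target q] && (r != j).

(** The only edges from x or x' to y or y' that could lead from row i to row j are those that the
    two bits delete. *)
Lemma trapped_step s t i j q r q' r' : bit s i j -> bit t i j ->
  layer_edge s t q r q' r' -> trapped i j q r -> trapped i j q' r'.
Proof.
have source_free : is_source q -> trapped i j q r = false.
  rewrite /is_source /trapped /is_target => /andP[q4 qb]; rewrite leqNgt qb /=.
  by case: q q4 {qb} => [|[|[|[|q]]]].
move=> bs bt; case/or4P => [/andP[/source_free-> //]|/and3P[/source_free-> //]|
                            /and3P[/eqP-> tq /eqP->]|].
  by rewrite /trapped /= tq !orbT /= => ->; rewrite orbT.
case/or4P => [/and3P[/eqP-> /eqP-> b0]|/and3P[/eqP-> /eqP-> /eqP->]|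
              /and3P[/eqP-> /eqP-> b0]|/and3P[/eqP-> /eqP-> /eqP->]] //.
- rewrite /trapped /= orbF => /eqP ri; apply/eqP => rj.
  by move: b0; rewrite ri rj bs.
- rewrite /trapped /= orbF => /eqP ri; apply/eqP => rj.
  by move: b0; rewrite ri rj bt.
Qed.

(** A path starting at [u] first enters a target, where it must end, or x_i, from where [trapped]
    keeps it away from [v]; so it is the edge itself. *)
Lemma spanner_dense k s t (H : digraph n) (i j : 'I_l) u v :
  bit s i j -> bit t i j -> is_spanner k (gadget_edges s t) H ->
  is_source (u %/ l) -> u %% l = i -> is_target (v %/ l) -> v %% l = j ->
  (u, v) \in H.
Proof.
move=> bs bt [HE Hs] su ui tv vj.
have [|p [up pv _]] := Hs u v; first by rewrite inE /layer_edge /= su tv.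
case: p up pv => [_ /= uv|w p /= /andP[uw wp] pv].
  by move: su tv; rewrite uv /is_source /is_target => /andP[_ h]; rewrite leqNgt h.
have pE x q : path [rel x y | (x, y) \in H] x q -> trapped i j (x %/ l) (x %% l) ->
    trapped i j (last x q %/ l) (last x q %% l).
  elim: q x => //= y q IH x /andP[xy yq] xt; apply: IH => //.
  have := fintype.subsetP HE _ xy; rewrite inE /= => xyE.
  exact: trapped_step bs bt xyE xt.
have vt : trapped i j (v %/ l) (v %% l) = false.
  rewrite /trapped vj eqxx andbF orbF; move: tv; rewrite /is_target.
  by move: (v %/ l) => q; case: q => [|[|[|q]]].
have := fintype.subsetP HE _ uw; rewrite inE /= => uwE.
have [tw|ntw] := boolP (is_target (w %/ l)).
  case: p wp pv => [_ /= <- //|x p /= /andP[wx _] _].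
  by have := fintype.subsetP HE _ wx; rewrite inE /= layer_edge_target.
have [qw rw] := layer_edge_source su ntw uwE.
by have := pE w p wp; rewrite pv vt qw -rw ui /trapped /= eqxx => /(_ isT).
Qed.

Lemma intersecting_spanner k s t (H : digraph n) : size s = l * l -> size t = l * l ->
  ~~ disjoint_words s t -> is_spanner k (gadget_edges s t) H ->
  b * b <= #|H :&: dense|.
Proof.
move=> sl tl nd Hs.
have [m [mlt /andP[sm tm]]] : exists m, m < l * l /\ nth false s m && nth false t m.
  apply: contrapT => nm; move/negP: nd; apply; apply/disjoint_wordsP; rewrite ?sl//.
  by move=> m mlt; apply/negP => st; apply: nm; exists m.
have il : m %/ l < l by rewrite ltn_divLR.
have jl : m %% l < l by rewrite ltn_mod.
pose i := Ordinal il; pose j := Ordinal jl.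
have bs : bit s i j by rewrite /bit /= -divn_eq.
have bt : bit t i j by rewrite /bit /= -divn_eq.
pose f (x : 'I_b * 'I_b) := (vertex (4 + x.1) i, vertex (b.+4 + x.2) j).
have lay1 (x : 'I_b) : 4 + x < (b + b).+4.
  by rewrite !addSn !add0n !ltnS (leq_trans (ltn_ord x))// leq_addr.
have lay2 (x : 'I_b) : b.+4 + x < (b + b).+4 by rewrite !addSn !ltnS ltn_add2l.
have finj : injective f.
  move=> [x y] [x' y'] fE; congr pair; apply: val_inj.
    have : vertex (4 + x) i %/ l = vertex (4 + x') i %/ l.
      exact: (congr1 (fun z : 'I_n * 'I_n => z.1 %/ l) fE).
    by rewrite !vertex_div// => /addnI.
  have : vertex (b.+4 + y) j %/ l = vertex (b.+4 + y') j %/ l.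
    exact: (congr1 (fun z : 'I_n * 'I_n => z.2 %/ l) fE).
  by rewrite !vertex_div// => /addnI.
have -> : b * b = #|f @: [set: 'I_b * 'I_b]|.
  by rewrite card_imset// cardsT card_prod card_ord.
apply/subset_leq_card/fintype.subsetP => _ /imsetP[[x y] _ ->].
have sx : is_source (vertex (4 + x) i %/ l).
  by rewrite vertex_div// /is_source leq_addr /= !addSn add0n !ltnS ltn_ord.
have ty : is_target (vertex (b.+4 + y) j %/ l).
  by rewrite vertex_div// /is_target leq_addr/=.
rewrite finset.in_setI; apply/andP; split; last by rewrite finset.in_set /f/= sx.
by apply: (spanner_dense bs bt Hs) => //; rewrite vertex_mod.
Qed.

End Gadget.

(** * Choice of parameters and conclusion *)

Lemma approx_spanner_le (R : realType) (k : nat) (a : R) (n : nat)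
    (E H H0 : digraph n) : 0 <= a ->
  is_approx_spanner k a E H -> is_spanner k E H0 -> #|H|%:R <= a * #|H0|%:R.
Proof.
move=> a0 [_ Hmin] H0s.
have H0p : `[< is_spanner k E H0 >] by apply/asboolP.
case: (@fintype.arg_minnP _ H0 (fun H1 : digraph n => `[< is_spanner k E H1 >])
  (fun H1 : digraph n => #|H1|) H0p) => H1 /asboolP H1s H1min.
apply: (le_trans (Hmin H1 _)).
  by split=> // H2 H2s; apply: H1min; apply/asboolP.
by apply: ler_wpM2l => //; rewrite ler_nat; apply: H1min.
Qed.

(** There are [3^(4 l T L)] transcripts, and [ln 3 <= 3]. *)
Lemma ln_card_transcript (R : realType) (T L l : nat) :
  ln #|{ffun 'I_T * ('I_l * bool * bool) -> {ffun 'I_L -> option bool}}|%:R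
    <= 12 * (L%:R * T%:R) * l%:R :> R.
Proof.
rewrite !card_ffun card_option !card_prod !card_bool !card_ord.
rewrite !natrX !lnXn ?exprn_gt0//.
have ln3 : ln (3 : R) <= 3 by apply: ltW; apply: ln_sublinear.
rewrite -mulrnA -[ln 3 *+ _]mulr_natr !natrM.
have : 0 <= L%:R * T%:R * l%:R :> R by rewrite !mulr_ge0.
move=> LTl; have := ler_wpM2l LTl ln3; lra.
Qed.

Lemma half_sub4_bounds (m : nat) : (4 <= m)%N ->
  (m <= (m - 4)./2 + (m - 4)./2 + 5)%N /\ (((m - 4)./2 + (m - 4)./2).+4 <= m)%N.
Proof.
move=> /subnK; move: (m - 4)%N => k <-; have := odd_double_half k.
rewrite -addnn; move: (k./2 + k./2)%N => h <-; split; last first.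
  by rewrite addn4 !ltnS leq_addl.
by rewrite (addnC (odd k)) -addnA leq_add2l; case: odd.
Qed.

(* [2 * (n + l * l)] bounds the size of the sparse spanner. *)
Lemma gadget_parameters (R : realType) (n : nat) (a : R) : 1 <= a ->
  a <= n%:R / 100 -> (200 <= n)%N ->
  exists l b : nat, [/\ (0 < l)%N, ((b + b).+4 * l <= n)%N,
    Num.sqrt n%:R / Num.sqrt a <= 8 * l%:R &
    a * (2 * (n + l * l))%:R < (b * b)%:R].
Proof.
move=> a1 an n200.
have n0 : 200 <= n%:R :> R by rewrite (ler_nat R 200 n).
set sn := Num.sqrt n%:R; set sa := Num.sqrt a.
have sa0 : 0 < sa by rewrite sqrtr_gt0; lra.
have sn0 : 0 < sn by rewrite sqrtr_gt0; lra.
have sn2 : sn * sn = n%:R by rewrite -expr2 sqr_sqrtr//; lra.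
have sa2 : sa * sa = a by rewrite -expr2 sqr_sqrtr//; lra.
have sa1 : 1 <= sa by rewrite -sqrtr1 ler_wsqrtr.
(* Since [y z = n], taking [l] near [y / 4] leaves room for [b] near [2 z]. Then [b^2] is about
   [4 a n], against [2 a (n + l^2)], about [2 a n + n / 8]; the bounds [y >= 10] and [z >= 14]
   absorb the rounding. *)
set y := sn / sa; set z := sn * sa.
have ysa : y * sa = sn by rewrite /y divfK// gt_eqF.
have y0 : 0 < y by rewrite divr_gt0.
have y10 : 10 <= y.
  rewrite /y ler_pdivlMr// -ler_sqr ?nnegrE; [|lra|lra].
  by rewrite exprMn !expr2 sn2 sa2; lra.
have nna : n%:R <= n%:R * a by rewrite ler_peMr//; lra.
have z14 : 14 <= z.
  rewrite -ler_sqr ?nnegrE; [|lra|by rewrite mulr_ge0// ltW].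
  rewrite /z exprMn !expr2 sn2 sa2; lra.
have z2 : z * z = n%:R * a by rewrite /z -sn2 -sa2; ring.
have yz : y * z = n%:R by rewrite -sn2 -{1}ysa /z; ring.
have ay2 : a * (y * y) = n%:R by rewrite -sn2 -ysa -sa2; ring.
pose l := Num.truncn (y / 4).
have [ly yl] : l%:R <= y / 4 /\ y / 4 < l%:R + 1.
  have := truncn_itv (_ : 0 <= y / 4); rewrite -/l => /(_ ltac:(lra)) /andP[h1 h2].
  by split=> //; rewrite natr1.
have lR : 3 / 2 < l%:R :> R by lra.
have l0 : (0 < l)%N by rewrite -(ltr_nat R); lra.
pose m := (n %/ l)%N; pose b := ((m - 4)./2)%N.
have nl : n%:R < (m%:R + 1) * l%:R :> R.
  by rewrite natr1 -natrM ltr_nat /m -ltn_divLR.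
have zm : 4 * z - 1 < m%:R.
  have : y * z < y * ((m%:R + 1) / 4).
    rewrite yz; apply: lt_le_trans nl _.
    have := ler_wpM2l (_ : 0 <= m%:R + 1 :> R) ly.
    by rewrite ?addr_ge0// => /(_ isT); lra.
  by rewrite ltr_pM2l//; lra.
have m4 : (4 <= m)%N by rewrite -(ler_nat R); lra.
have [mb bm] := half_sub4_bounds m4; rewrite -/b in mb bm.
have b2 : m%:R <= 2 * b%:R + 5 :> R.
  by move: mb; rewrite -(ler_nat R) !natrD; lra.
exists l, b; split=> //.
- apply: (@leq_trans (m * l)); last exact: leq_trunc_div.
  by rewrite leq_mul2r bm orbT.
- lra.
rewrite natrM natrD !natrM.
have bz : 2 * z - 3 < b%:R by lra.
have : (2 * z - 3) * (2 * z - 3) <= b%:R * b%:R by apply: ler_pM; lra.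
have : a * (l%:R * l%:R) <= a * ((y / 4) * (y / 4)).
  apply: ler_wpM2l; first lra.
  by apply: ler_pM => //; lra.
have : 14 * z <= z * z by rewrite ler_pM2r//; lra.
lra.
Qed.

Theorem theorem1 (R : realType) (dO : measure_display)
    (Omega : measurableType dO) (P : probability Omega R)
    (flip : nat -> nat -> Omega -> bool) (hflip : fair_coins P flip)
    (k : nat) (hk : (5 <= k)%N)
    (alpha : nat -> R)
    (halpha_ge1 : forall n : nat, 1 <= alpha n)
    (halpha_mono : forall m n : nat, (m <= n)%N -> alpha m <= alpha n)
    (halpha_theta : theta_stable alpha)
    (d : nat) (hd : (0 < d)%N) (B : R) :
  exists (c : R) (N : nat), 0 < c /\
    forall A : algorithm,
      is_congest B d A ->
      is_approx_algorithm P flip k alpha d A ->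
      forall n : nat, (N <= n)%N -> alpha n <= n%:R / 100%:R ->
        exists G : network d n,
          takes_rounds P flip A G
            (c * (Num.sqrt n%:R / (Num.sqrt (alpha n) * ln n%:R))).
Proof.
set B' := Num.max B 0.
have B0 : 0 <= B' by rewrite /B' le_max lexx orbT.
(* [96 = 12 * 8], with 12 from [ln_card_transcript] and 8 from the lower bound on [l]; [B' + 1] is
   positive for every [B]. *)
pose c := disj_rate R / (96 * (B' + 1)).
have B1 : 0 < 96 * (B' + 1) by rewrite mulr_gt0//; lra.
have c0 : 0 < c by rewrite divr_gt0// disj_rate_gt0.
exists c, 200%N; split=> // A Acongest Aapprox n n200 an.
have [l [b [l0 bl y8l ab]]] := gadget_parameters (halpha_ge1 n) an n200.
apply: contrapT => /forallNP fast.
have n1 : 1 < n%:R :> R by rewrite ltr1n (leq_trans _ n200).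
have lnn : 0 < ln n%:R :> R by exact: ln_gt0.
set y := Num.sqrt n%:R / Num.sqrt (alpha n) in y8l.
have y0 : 0 <= y by rewrite divr_ge0 ?sqrtr_ge0.
set x := c * _ in fast.
have xE : x = c * y / ln n%:R by rewrite /x /y invfM !mulrA.
have [c0' lnn0] := (ltW c0, ltW lnn).
have x0 : 0 <= x by rewrite xE divr_ge0// mulr_ge0.
pose T := Num.truncn x; pose L := Num.truncn (B' * ln n%:R).
have Tx : T%:R <= x by rewrite truncn_le.
have LB : L%:R <= B' * ln n%:R by rewrite truncn_le// mulr_ge0.
pose net s t := gadget n l b hd s t.
have /choice[S HS] : forall st : seq bool * seq bool, exists S : set Omega,
    [/\ measurable S,
        (S `<=` [set w | succeeds flip k (alpha n) A (net st.1 st.2) w])%classic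
      & ((2 / 3)%:E <= P S)%E] by move=> st; exact: Aapprox.
have short (r : 'I_n -> tape) s t i u v : linked (net s t) u v ->
    (size (message (net s t) (run A (net s t) r i) u v) <= L)%N.
  move=> luv; rewrite truncn_ge_nat ?mulr_ge0//.
  apply: le_trans (Acongest _ _ _ _ _ _ luv) _.
  by rewrite ler_wpM2r// /B' le_max lexx.
have : ln #|{ffun 'I_T * ('I_l * bool * bool) -> {ffun 'I_L -> option bool}}|%:R
    <= disj_rate R * (l * l)%:R.
  apply: le_trans (ln_card_transcript R T L l) _.
  have LT : L%:R * T%:R <= B' * (c * y).
    have -> : B' * (c * y) = B' * ln n%:R * x by rewrite xE; field; rewrite gt_eqF.
    by apply: ler_pM.
  have cB : c * (96 * (B' + 1)) = disj_rate R by rewrite divfK// gt_eqF.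
  have l0R : 0 <= l%:R :> R by [].
  have h1 := ler_wpM2r l0R LT.
  have h2 := ler_wpM2l (mulr_ge0 (mulr_ge0 B0 c0') l0R) y8l.
  have h3 := mulr_ge0 c0' (mulr_ge0 l0R l0R).
  rewrite natrM -cB; lra.
rewrite leNgt => /negP; apply.
apply: (@disjointness_lower_bound R dO Omega P (l * l) _
  (fun w => transcript hd bl A (tapes flip w) T L)
  (fun w => accepts l b hd A (tapes flip w) T)
  (fun s t => S (s, t))) => [s t|s t||| ].
- by have [] := HS (s, t).
- by have [] := HS (s, t).
(* There are finitely many inputs, so one null set serves them all. *)
- have halts : {ae P, forall w, forall st : (l * l).-tuple bool * (l * l).-tuple bool,
      exists t : nat, all_halted A (net st.1 st.2) (tapes flip w) t /\ t%:R < x}.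
    apply: filter_forall => -[s t]; exact: contrapT (fast (net s t)).
  apply: filterS halts => w halts; split.
    by apply: (transcript_rectangular l0 bl); exact: short.
  move=> s t sl tl Sw.
  have [t1 [/= h1 t1x]] := halts (Tuple (introT eqP sl), Tuple (introT eqP tl)).
  have [_ /(_ _ Sw) [t0 [/= h0 [Hs Hmin]]] _] := HS (s, t).
  have t1T : (t1 <= T)%N by rewrite truncn_ge_nat// ltW.
  (* Halted states are frozen, so the output after [T] rounds is the one that succeeded at time
     [t0], whichever of the two comes first. *)
  have runE : run A (net s t) (tapes flip w) T = run A (net s t) (tapes flip w) t0.
    rewrite (run_halted h1 t1T) -(run_halted h1 (leq_maxl t1 t0)).
    by rewrite (run_halted h0 (leq_maxr t1 t0)).
  have outE : output_graph A (net s t) (tapes flip w) T =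
      output_graph A (net s t) (tapes flip w) t0.
    by rewrite /output_graph runE.
  rewrite /accepts outE.
  have [dst|dst] := boolP (disjoint_words s t).
    have sp := disjoint_spanner l0 bl hk sl tl dst.
    have a0 : 0 <= alpha n by apply: le_trans (halpha_ge1 n).
    have Hle := approx_spanner_le a0 (conj Hs Hmin) sp.
    rewrite -(ltr_nat R); apply: le_lt_trans ab.
    apply: le_trans (le_trans Hle _); first by rewrite ler_nat subset_leq_card ?subsetIl.
    by rewrite ler_wpM2l// ler_nat card_sparse.
  apply/negbTE; rewrite -leqNgt.
  exact: (intersecting_spanner l0 bl sl tl dst Hs).
- by rewrite muln_gt0 l0.
- by apply/card_gt0P; exists [ffun=> [ffun=> None]].
Qed.
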